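(* If $f:[0,\infty)\to\mathbb{R}$ is a continuous convex function and $B_1,\ldots,B_n$ are positive operators on $\mathscr{H}$ such that $\sum_{i=1}^{n}B_i=MI$ for some scalar $M>0$, then $$\sum_{i=1}^{n}f(B_i)\leq f\left(\sum_{i=1}^{n}B_i\right)+(n-1)f(0)-\delta_f\widetilde{B}\leq f\left(\sum_{i=1}^{n}B_i\right)+(n-1)f(0),$$ where $\delta_f=f(0)+f(M)-2f\left(\frac{M}{2}\right)$ and $\widetilde{B}=\frac{n}{2}-\sum_{i=1}^{n}\left|\frac{B_i}{M}-\frac12\right|$.
   Context: $\mathscr{H}$ is a complex Hilbert space, $I$ the identity operator; operators are bounded linear operators on $\mathscr{H}$, and positive means positive semidefinite. The order $\leq$ on self-adjoint operators is the usual one ($S\leq T$ iff $T-S$ is positive); a scalar in an operator expression stands for that scalar times $I$. $f(T)$ is defined by continuous functional calculus and $|T|=(T^2)^{1/2}$. All real-valued functions are assumed continuous throughout the paper. In the paper $\delta_f=f(m)+f(M)-2f(\frac{m+M}{2})$, used here with $m=0$. *)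

(* Defs.v *)
From HB Require Import structures.
From mathcomp Require Import all_boot all_order all_algebra.
From mathcomp Require Import sesquilinear.
From mathcomp Require Import complex.
From mathcomp Require Import all_classical all_reals all_analysis.
Set Implicit Arguments.
Unset Strict Implicit.
Unset Printing Implicit Defensive.
Import Order.TTheory GRing.Theory Num.Theory.
Import numFieldNormedType.Exports.
Local Open Scope classical_set_scope.
Local Open Scope complex_scope.
Local Open Scope ring_scope.

(* The inner product is linear in its first argument and conjugate-linear in
   the second one. *)
HB.mixin Record CompleteNormedModule_isHilbert (R : realType) H
    of CompleteNormedModule R[i] H := {
  hdot : {dot H for (@Num.conj R[i])};
  hdotE : forall x : H, `|x| ^+ 2 = hdot x x
}.

#[short(type="hilbertType")]
HB.structure Definition Hilbert (R : realType) :=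
  {H of CompleteNormedModule_isHilbert R H & CompleteNormedModule R[i] H}.

Section Operators.
Variables (R : realType) (H : hilbertType R).
Implicit Types (S T : H -> H) (p : {poly R}) (f : R -> R).

(* Operators are functions H -> H, added and scaled pointwise. *)
Definition bounded_operator T : Prop :=
  linear T /\ exists r : R, forall x, `|T x| <= r%:C * `|x|.

(* The order of R[i] makes 0 <= z mean that z is real and nonnegative. *)
Definition positive_operator T : Prop :=
  bounded_operator T /\ forall x, 0 <= hdot (T x) x.

Definition le_operator S T : Prop := positive_operator (T - S).

Definition scalar_operator (a : R) : H -> H := fun x => a%:C *: x.

Definition opnorm T : R :=
  sup [set complex.Re `|T x| | x in [set x : H | `|x| <= 1]].

Definition invertible_operator T : Prop :=
  exists S, [/\ bounded_operator S, T \o S = id & S \o T = id].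

(* The real points of the spectrum: all of it when T is self-adjoint. *)
Definition real_spectrum T : set R :=
  [set t | ~ invertible_operator (T - scalar_operator t)].

Definition poly_operator p T : H -> H :=
  \sum_(k < size p) (p`_k)%:C *: iter k T.

Definition is_cfc f T S : Prop :=
  bounded_operator S /\
  exists p : nat -> {poly R},
    {uniform real_spectrum T, (fun k t => (p k).[t]) @ \oo --> f} /\
    opnorm (poly_operator (p k) T - S) @[k --> \oo] --> (0 : R).

(* Continuous functional calculus f(T) of a self-adjoint operator T, for f
   continuous on the spectrum of T: the operator-norm limit of p_k(T) for real
   polynomials p_k converging to f uniformly on the spectrum.  The value 0 is a
   default that is taken only if no such limit exists. *)
Definition cfc f T : H -> H := xget 0 [set S | is_cfc f T S].

Definition abs_operator T : H -> H := cfc Num.sqrt (T \o T).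

End Operators.
Arguments scalar_operator {R H} a.

(* Main.v *)
Require Import Defs.
From HB Require Import structures.
From mathcomp Require Import all_boot all_order all_algebra.
From mathcomp Require Import sesquilinear complex ring lra.
From mathcomp Require Import all_classical all_reals all_analysis.
Import Order.TTheory GRing.Theory Num.Theory.
Import numFieldNormedType.Exports.
Local Open Scope classical_set_scope.
Local Open Scope complex_scope.
Local Open Scope ring_scope.

(** The inequality holds because it holds on the spectrum.  Write [delta] for the
    midpoint gap [f 0 + f M - 2 f (M / 2)].  On each half of [[0, M]] a convex
    function lies below the chord joining its values at the endpoints of that
    half, and the two chords together say that
    [f t <= f 0 + (f M - f 0) / M * t - delta * (1/2 - |t / M - 1/2|)]
    ([refined_chord_le]).  The operators [B i] are positive with sum [M], so each
    satisfies [0 <= B i <= M] and has its spectrum in [[0, M]]; the functional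
    calculus turns the scalar inequality at [t] into an operator inequality at
    [B i].  Summing over [i], the linear terms add up to [f M - f 0], the constant
    ones to [n * f 0], and the last ones to [delta] times [Btilde].  The second
    inequality says that [delta * Btilde] is positive: [delta >= 0] is midpoint
    convexity, and [1/2 - |t / M - 1/2| >= 0] on [[0, M]].

    The bulk of the work is the functional calculus of a bounded self-adjoint
    operator [T].  Its key is that a real polynomial that is nonnegative on the
    spectrum is nonnegative at [T] ([poly_pos]).  For [s > 0] the polynomial
    [p + s] has no root in the spectrum; it splits over the complex numbers, and
    each factor [T - z] is invertible, by definition for real [z] outside the
    spectrum and by coercivity for non-real [z].  So [p(T) + s] is invertible for
    every [s > 0], and a self-adjoint operator with that property is positive
    ([pos_of_invertible]): the infimum of its quadratic form, if negative, could
    be increased.  Applied to [e^2 - p^2], this bounds the norm of [p(T)] by the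
    supremum of [|p|] over the spectrum ([poly_norm_le]), which gives uniqueness
    of the functional calculus, its existence by completeness and the Weierstrass
    theorem, and its positivity ([has_cfc_pos]).  The absolute value
    [|B / M - 1/2|], defined through the square root of a square, is identified
    with the function [|t / M - 1/2|] of [B] in [has_cfc_abs]. *)

Set Implicit Arguments.
Unset Strict Implicit.
Unset Printing Implicit Defensive.

(** * The real inner product of a complex Hilbert space *)

Section RealGeometry.
Variables (R : realType) (H : hilbertType R).
Implicit Types (x y z : H) (a : R) (w : R[i]) (S T : H -> H).

(** Every estimate is made with real numbers: the norm and the real part of the
    inner product.  Nothing is lost, since the imaginary part of [hdot x y] is
    [rdot x ('i *: y)], and the order of [R] is total whereas that of [R[i]] is
    not. *)
Definition nrm x : R := complex.Re `|x|.
Definition rdot x y : R := complex.Re (hdot x y).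

Lemma normE x : `|x| = (nrm x)%:C.
Proof. by rewrite [LHS]complexE /nrm (ger0_Im (normr_ge0 x)) mulr0 addr0. Qed.

Lemma nrm_ge0 x : 0 <= nrm x.
Proof. by rewrite -ler0c -normE. Qed.

Lemma nrmD x y : nrm (x + y) <= nrm x + nrm y.
Proof. by rewrite -lecR rmorphD /= -!normE ler_normD. Qed.

Lemma nrmZ w x : nrm (w *: x) = complex.Re `|w| * nrm x.
Proof. by rewrite {1}/nrm normrZ (normE x) normc_def /= mulr0 subr0. Qed.

Lemma nrmZr a x : nrm (a%:C *: x) = `|a| * nrm x.
Proof. by rewrite nrmZ normc_def /= expr0n /= addr0 sqrtr_sqr. Qed.

Lemma nrmN x : nrm (- x) = nrm x.
Proof. by rewrite /nrm normrN. Qed.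

Lemma nrm0 : nrm 0 = 0.
Proof. by rewrite /nrm normr0. Qed.

Lemma nrm_eq0 x : nrm x = 0 -> x = 0.
Proof. by move=> x0; apply/eqP; rewrite -normr_eq0 normE x0. Qed.

Lemma nrm_triangle x y z : nrm (x - z) <= nrm (x - y) + nrm (y - z).
Proof. by rewrite -(subrKA y) nrmD. Qed.

Lemma nrm_distC x y : nrm (x - y) = nrm (y - x).
Proof. by rewrite -opprB nrmN. Qed.

Lemma rdotxx x : rdot x x = nrm x ^+ 2.
Proof. by rewrite /rdot -hdotE normE -rmorphXn. Qed.

Lemma hdotC x y : hdot x y = (hdot y x)^*.
Proof. by rewrite hermC expr0 mul1r. Qed.

Lemma rdotC x y : rdot x y = rdot y x.
Proof. by rewrite /rdot hdotC; case: (hdot y x). Qed.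

Lemma rdotDl x y z : rdot (x + y) z = rdot x z + rdot y z.
Proof. by rewrite /rdot linearDl raddfD. Qed.

Lemma rdotZl a x y : rdot (a%:C *: x) y = a * rdot x y.
Proof.
by rewrite /rdot linearZl_LR /=; case: (hdot x y) => u v /=; rewrite mul0r subr0.
Qed.

Lemma rdotNl x y : rdot (- x) y = - rdot x y.
Proof. by rewrite /rdot linearNl raddfN. Qed.

Lemma rdotDr x y z : rdot x (y + z) = rdot x y + rdot x z.
Proof. by rewrite !(rdotC x) rdotDl. Qed.

Lemma rdotZr a x y : rdot x (a%:C *: y) = a * rdot x y.
Proof. by rewrite !(rdotC x) rdotZl. Qed.

Lemma rdotNr x y : rdot x (- y) = - rdot x y.
Proof. by rewrite !(rdotC x) rdotNl. Qed.

Lemma rdot_suml n (F : 'I_n -> H) y : rdot (\sum_i F i) y = \sum_i rdot (F i) y.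
Proof.
elim/big_ind2: _ => [|x a z b <- <-|//]; last exact: rdotDl.
by rewrite /rdot linear0l.
Qed.

Lemma rdot_iZl x y : rdot ('i *: x) y = - complex.Im (hdot x y).
Proof. by rewrite /rdot linearZl_LR /= mulrC ReiNIm. Qed.

Lemma rdot_iZr x y : rdot x ('i *: y) = complex.Im (hdot x y).
Proof. by rewrite rdotC rdot_iZl hdotC; case: (hdot x y) => u v /=; rewrite opprK. Qed.

(** The source of Cauchy-Schwarz for any nonnegative quadratic form: minimize
    over [t] when [r > 0]; when [r = 0] an affine function bounded below is
    constant. *)
Lemma discriminant_le (p q r : R) : 0 <= r ->
  (forall t, 0 <= p + 2 * t * q + t ^+ 2 * r) -> q ^+ 2 <= p * r.
Proof.
move=> r0 h; have [r_eq0|r_neq0] := eqVneq r 0.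
  have [->|q0] := eqVneq q 0; first by rewrite r_eq0 expr0n mulr0.
  (* at this [t] the affine function [p + 2 t q] takes the value -1 *)
  have := h (- (p + 1) / (2 * q)); rewrite r_eq0 mulr0 addr0.
  have -> : 2 * (- (p + 1) / (2 * q)) * q = - (p + 1) by field.
  lra.
have rp : 0 < r by rewrite lt_neqAle eq_sym r_neq0.
have := h (- q / r).
have -> : p + 2 * (- q / r) * q + (- q / r) ^+ 2 * r = (p * r - q ^+ 2) / r.
  by field.
by rewrite pmulr_lge0 ?invr_gt0 // subr_ge0.
Qed.

End RealGeometry.

(** * Bounded operators and completeness *)

Section BoundedOperators.
Variables (R : realType) (H : hilbertType R).
Implicit Types (x y z : H) (a c C : R) (w : R[i]) (S T A : H -> H).

Section LinearAsProp.
Variables (T : H -> H) (Tlin : linear T).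

Lemma linD x y : T (x + y) = T x + T y.
Proof. by have := Tlin 1 x y; rewrite !scale1r. Qed.

Lemma lin0 : T 0 = 0.
Proof. by apply: (addrI (T 0)); rewrite -linD !addr0. Qed.

Lemma linZ w x : T (w *: x) = w *: T x.
Proof. by have := Tlin w x 0; rewrite lin0 !addr0. Qed.

Lemma linN x : T (- x) = - T x.
Proof. by rewrite -scaleN1r linZ scaleN1r. Qed.

Lemma linB x y : T (x - y) = T x - T y.
Proof. by rewrite linD linN. Qed.

End LinearAsProp.

(** The bound of a bounded operator is some real number, possibly negative on
    the zero space; taking it nonnegative makes it usable as a factor. *)
Lemma bounded_operatorP T : bounded_operator T <->
  linear T /\ exists2 C : R, 0 <= C & forall x, nrm (T x) <= C * nrm x.
Proof.
split=> [[Tlin [C hC]]|[Tlin [C C0 hC]]]; split=> //.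
  exists `|C| => // x; apply: le_trans (_ : C * nrm x <= _).
    by have := hC x; rewrite !normE -rmorphM lecR.
  by rewrite ler_wpM2r ?nrm_ge0 // ler_norm.
by exists C => x; rewrite !normE -rmorphM lecR.
Qed.

Lemma bounded_lin T : bounded_operator T -> linear T.
Proof. by case. Qed.

Lemma bounded_scale w T : bounded_operator T -> bounded_operator (w *: T).
Proof.
move=> /bounded_operatorP[Tlin [C C0 hC]]; apply/bounded_operatorP; split.
  by move=> b x y; rewrite !fctE Tlin scalerDr !scalerA mulrC.
have w0 : 0 <= complex.Re `|w| by rewrite normc_def /= sqrtr_ge0.
exists (complex.Re `|w| * C) => [|x]; first exact: mulr_ge0.
by rewrite nrmZ -mulrA ler_wpM2l.
Qed.

Lemma bounded_add S T :
  bounded_operator S -> bounded_operator T -> bounded_operator (S + T).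
Proof.
move=> /bounded_operatorP[Slin [C C0 hC]] /bounded_operatorP[Tlin [D D0 hD]].
apply/bounded_operatorP; split.
  by move=> b x y; rewrite !fctE Slin Tlin scalerDr addrACA.
exists (C + D) => [|x]; first exact: addr_ge0.
by rewrite mulrDl (le_trans (nrmD _ _)) // lerD.
Qed.

Lemma bounded_opp T : bounded_operator T -> bounded_operator (- T).
Proof. by move=> /(bounded_scale (-1)); rewrite scaleN1r. Qed.

Lemma bounded_sub S T :
  bounded_operator S -> bounded_operator T -> bounded_operator (S - T).
Proof. by move=> hS /bounded_opp; exact: bounded_add. Qed.

Lemma bounded_id : bounded_operator (id : H -> H).
Proof.
by apply/bounded_operatorP; split=> //; exists 1 => // x; rewrite mul1r.
Qed.

Lemma bounded_scalar a : bounded_operator (scalar_operator a : H -> H).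
Proof. exact: bounded_scale bounded_id. Qed.

Lemma bounded0 : bounded_operator (0 : H -> H).
Proof. by rewrite -(scale0r (id : H -> H)); exact: bounded_scale bounded_id. Qed.

Lemma bounded_sum n (F : 'I_n -> H -> H) :
  (forall i, bounded_operator (F i)) -> bounded_operator (\sum_i F i).
Proof. by move=> hF; elim/big_ind: _ => //; [exact: bounded0|exact: bounded_add]. Qed.

Lemma bounded_comp S T :
  bounded_operator S -> bounded_operator T -> bounded_operator (S \o T).
Proof.
move=> /bounded_operatorP[Slin [C C0 hC]] /bounded_operatorP[Tlin [D D0 hD]].
apply/bounded_operatorP; split; first by move=> b x y /=; rewrite Tlin Slin.
exists (C * D) => [|x /=]; first exact: mulr_ge0.
by rewrite (le_trans (hC _)) // -mulrA ler_wpM2l.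
Qed.

(** Completeness transported to the real-valued norm.  The Cauchy hypothesis
    compares with the single index [N], which implies the usual two-index
    condition by the triangle inequality. *)
Lemma cauchy_limit (u : nat -> H) :
  (forall e, 0 < e -> exists N, forall k, (N <= k)%N -> nrm (u N - u k) <= e) ->
  exists l, forall e, 0 < e ->
    exists N, forall k, (N <= k)%N -> nrm (l - u k) <= e.
Proof.
move=> hu.
have /cvg_ex[/= l hl] : cvgn u.
  apply/cauchy_cvgP/cauchy_exP => eps eps0.
  have epsE : eps = (complex.Re eps)%:C.
    by rewrite [LHS]complexE (ger0_Im (ltW eps0)) mulr0 addr0.
  have e0 : 0 < complex.Re eps by rewrite -ltcR -epsE.
  have [N hN] := hu _ (divr_gt0 e0 (ltr0n _ 2)).
  exists (u N), N => // k /= Nk.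
  rewrite -ball_normE /= normE epsE ltcR.
  by rewrite (le_lt_trans (hN k Nk)) // ltr_pdivrMr // ltr_pMr // ltr1n.
exists l => e e0.
have /cvgrPdist_le/(_ e%:C) := hl.
rewrite ltcR => /(_ e0)[N _ hN]; exists N => k Nk.
by have /= := hN k Nk; rewrite normE lecR.
Qed.

End BoundedOperators.

(** * Self-adjointness and invertibility of coercive operators *)

Section Coercivity.
Variables (R : realType) (H : hilbertType R).
Implicit Types (x y z : H) (a c C e q : R) (w : R[i]) (S T A F : H -> H).

(** Self-adjointness tested on the real part of the inner product only; for a
    complex-linear operator this is equivalent to the complex condition. *)
Definition selfadjoint T := forall x y, rdot (T x) y = rdot x (T y).

Lemma selfadjoint_Im0 T x : linear T -> selfadjoint T -> complex.Im (hdot (T x) x) = 0.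
Proof.
move=> Tlin /(_ ('i *: x) x); rewrite (linZ Tlin) !rdot_iZl (hdotC x).
by case: (hdot (T x) x) => u v /= h; lra.
Qed.

(** Self-adjointness of a positive operator is polarization: the quadratic form
    of [T] is real at [x + i y], and its imaginary part there is the defect of
    symmetry of the pair [x], [y].  Conversely, testing symmetry on [i x] and [x]
    shows that the quadratic form is real ([selfadjoint_Im0]). *)
Lemma positive_operatorP T : positive_operator T <->
  [/\ bounded_operator T, selfadjoint T & forall x, 0 <= rdot (T x) x].
Proof.
split=> [[Tb Tpos]|[Tb Tsym Tpos]]; last first.
  split=> // x; have ImT := selfadjoint_Im0 x (bounded_lin Tb) Tsym.
  by rewrite lecE ImT eqxx; exact: Tpos.
have Tlin := bounded_lin Tb.
have ImT z : complex.Im (hdot (T z) z) = 0 by exact: ger0_Im.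
split=> // [x y|x]; last by have := Tpos x; rewrite lecE => /andP[].
have := ImT (x + 'i *: y).
rewrite -rdot_iZr scalerDr scalerA -expr2 sqr_i.
rewrite (linD Tlin) (linZ Tlin) !(rdotDl, rdotDr) scaleN1r !rdotNr.
have -> : rdot ('i *: T y) ('i *: x) = rdot (T y) x.
  by rewrite rdot_iZr linearZl_LR /= mulrC ImiRe.
by rewrite rdot_iZr rdot_iZl !ImT (rdotC x) => h; lra.
Qed.

(** A positive operator defines a second inner product, possibly degenerate; the
    Cauchy-Schwarz inequality of that form is what bounds [nrm (S x)] by the
    quadratic form of [S] in [pos_invertible_below]. *)
Lemma pos_form_CS S x y : linear S -> selfadjoint S -> (forall z, 0 <= rdot (S z) z) ->
  rdot (S x) y ^+ 2 <= rdot (S x) x * rdot (S y) y.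
Proof.
move=> Slin Ssym Spos; apply: discriminant_le => // t.
have := Spos (x + t%:C *: y).
rewrite (linD Slin) (linZ Slin) !(rdotDl, rdotDr, rdotZl, rdotZr).
rewrite [rdot (S y) x]Ssym [rdot y _]rdotC.
by congr (_ <= _); ring.
Qed.

Lemma rdot_le x y : rdot x y <= nrm x * nrm y.
Proof.
have := @pos_form_CS id x y (fun _ _ _ => erefl) (fun _ _ => erefl).
rewrite !rdotxx -exprMn => /(_ (fun z => _)) h.
have {h} : rdot x y ^+ 2 <= (nrm x * nrm y) ^+ 2.
  by apply: h => z; rewrite rdotxx sqr_ge0.
rewrite -ler_sqrt ?sqr_ge0 // !sqrtr_sqr.
rewrite (ger0_norm (mulr_ge0 (nrm_ge0 x) (nrm_ge0 y))).
exact: le_trans (ler_norm _).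
Qed.

Lemma nrm_le0_eps x : (forall e, 0 < e -> nrm x <= e) -> x = 0.
Proof.
move=> h; apply: nrm_eq0; apply/eqP; rewrite eq_le nrm_ge0 andbT.
by apply/ler_addgt0Pr => e /h; rewrite add0r.
Qed.

Lemma expr_small q e : 0 <= q -> q < 1 -> 0 < e -> exists N, q ^+ N <= e.
Proof.
move=> q0 q1 e0; have q1' : `|q| < 1 by rewrite ger0_norm.
have /cvgrPdist_le/(_ e e0)[N _ hN] := cvg_expr q1'.
exists N; have /= := hN N (leqnn N).
by rewrite sub0r normrN ger0_norm // exprn_ge0.
Qed.

(** Banach's fixed point theorem for the real-valued norm: the tails of the
    orbit of 0 are dominated by a geometric series. *)
Lemma contraction_fixpoint F q : 0 <= q -> q < 1 ->
  (forall x y, nrm (F x - F y) <= q * nrm (x - y)) -> exists x, F x = x.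
Proof.
move=> q0 q1 hF; pose u k := iter k F 0; pose d := nrm (u 0 - u 1).
have q1' : 0 < 1 - q by rewrite subr_gt0.
have tail0 m : nrm (u 0 - u m) <= d / (1 - q).
  elim: m => [|m IH]; first by rewrite subrr nrm0 divr_ge0 ?nrm_ge0 // ltW.
  have -> : d / (1 - q) = d + q * (d / (1 - q)) by field; rewrite gt_eqF.
  apply: le_trans (nrm_triangle _ (u 1) _) _; rewrite lerD2l.
  exact: le_trans (hF _ _) (ler_wpM2l q0 IH).
have tail N m : nrm (u N - u (N + m)) <= q ^+ N * (d / (1 - q)).
  elim: N => [|N IH]; first by rewrite expr0 mul1r.
  by rewrite exprS -mulrA; exact: le_trans (hF _ _) (ler_wpM2l q0 IH).
have D0 : 0 <= d / (1 - q) by rewrite divr_ge0 ?nrm_ge0 // ltW.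
have [] := @cauchy_limit _ _ u.
  move=> e e0.
  have [N hN] := expr_small q0 q1 (divr_gt0 e0 (ltr_wpDl D0 ltr01)).
  exists N => k Nk; rewrite -(subnKC Nk); apply: le_trans (tail _ _) _.
  apply: le_trans (ler_wpM2r D0 hN) _.
  rewrite -mulrA ler_piMr ?(ltW e0) // mulrC ler_pdivrMr ?mul1r ?lerDl //.
  exact: ltr_wpDl.
move=> l hl; exists l; apply: subr0_eq; apply: nrm_le0_eps => e e0.
have [N hN] := hl _ (divr_gt0 e0 (ltr0n _ 2)).
apply: le_trans (nrm_triangle _ (u N.+1) _) _.
rewrite [e]splitr lerD // 1?nrm_distC ?hN //.
rewrite nrm_distC; apply: le_trans (hF _ _) _.
apply: le_trans (hN _ (leqnn _)); rewrite ler_piMl ?nrm_ge0 //; exact: ltW.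
Qed.

(** The Lax-Milgram argument: solving [A x = y] amounts to finding a fixed point
    of [x - r (A x - y)], and coercivity makes this map a contraction for small
    [r > 0]. *)
Lemma coercive_surj A c : bounded_operator A -> 0 < c ->
  (forall x, c * nrm x ^+ 2 <= rdot (A x) x) -> forall y, exists x, A x = y.
Proof.
move=> /bounded_operatorP[Alin [C C0 hC]] c0 hA y.
pose D := C ^+ 2 + c ^+ 2.
have D0 : 0 < D by rewrite ltr_wpDl ?sqr_ge0 // exprn_gt0.
(* [r] satisfies [r^2 C^2 <= r c], so that [|x - r A x|^2] is at most
   [1 - 2 r c + r^2 C^2 <= 1 - r c] times [|x|^2] *)
pose r := c / D.
have r0 : 0 < r by exact: divr_gt0.
pose q2 := 1 - r * c.
have q20 : 0 <= q2.
  rewrite subr_ge0 mulrAC ler_pdivrMr // mul1r -expr2 lerDr; exact: sqr_ge0.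
have q21 : q2 < 1 by rewrite gtrBl mulr_gt0.
have [||x|x hx] := @contraction_fixpoint (fun x => x - r%:C *: (A x - y)) (Num.sqrt q2).
- exact: sqrtr_ge0.
- by rewrite -sqrtr1 ltr_sqrt.
- move=> z; have -> : x - r%:C *: (A x - y) - (z - r%:C *: (A z - y)) =
      (x - z) - r%:C *: A (x - z).
    by rewrite opprD addrACA -opprD -scalerBr opprB addrA subrK (linB Alin).
  move: (x - z) => {x z} t.
  have h : nrm (t - r%:C *: A t) ^+ 2 <= q2 * nrm t ^+ 2.
    rewrite -rdotxx !(rdotDl, rdotDr, rdotNl, rdotNr, rdotZl, rdotZr) !rdotxx.
    rewrite (rdotC t).
    have h1 := hA t.
    have h2 : nrm (A t) ^+ 2 <= D * nrm t ^+ 2.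
      apply: le_trans (_ : (C * nrm t) ^+ 2 <= _).
        by rewrite ler_sqr ?nnegrE ?hC ?mulr_ge0 ?nrm_ge0.
      rewrite exprMn ler_wpM2r ?sqr_ge0 // lerDl; exact: sqr_ge0.
    have h3 : r * r * nrm (A t) ^+ 2 <= r * c * nrm t ^+ 2.
      have -> : r * c = r * r * D by rewrite /r; field; rewrite gt_eqF.
      by rewrite -[leRHS]mulrA ler_wpM2l // mulr_ge0 ?ltW.
    have h4 : r * (c * nrm t ^+ 2) <= r * rdot (A t) t by rewrite ler_wpM2l // ltW.
    rewrite /q2; lra.
  rewrite -[leLHS]ger0_norm ?nrm_ge0 // -[nrm t]ger0_norm ?nrm_ge0 //.
  by rewrite -!sqrtr_sqr -sqrtrM // ler_sqrt // mulr_ge0 ?sqr_ge0.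
exists x; apply: subr0_eq; apply: nrm_eq0.
have : nrm (r%:C *: (A x - y)) = 0.
  by rewrite -[_ *: _](subKr x) hx subrr nrm0.
rewrite nrmZr => /eqP; rewrite mulf_eq0 normr_eq0 gt_eqF //= => /eqP.
exact.
Qed.

Lemma bounded_below_invertible T c : bounded_operator T -> 0 < c ->
  (forall x, c * nrm x <= nrm (T x)) -> (forall y, exists x, T x = y) ->
  invertible_operator T.
Proof.
move=> Tb c0 hc /choice[S TS]; have Tlin := bounded_lin Tb.
have Tinj x y : T x = T y -> x = y.
  move=> Txy; apply: subr0_eq; apply: nrm_eq0; apply/eqP.
  rewrite eq_le nrm_ge0 andbT -(ler_pM2l c0) mulr0.
  by rewrite (le_trans (hc _)) // (linB Tlin) Txy subrr nrm0.
exists S; split; [|by apply/funext=> x /=|by apply/funext=> x; apply: Tinj => /=].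
apply/bounded_operatorP; split.
  by move=> b x y; apply: Tinj; rewrite (linD Tlin) (linZ Tlin) !TS.
exists c^-1 => [|x]; first by rewrite invr_ge0 ltW.
by rewrite mulrC ler_pdivlMr // mulrC -{2}(TS x).
Qed.

(** The complex factor [w] lets the same criterion serve below the spectrum,
    above it and off the real axis, by rotating [T] until its real part is positive. *)
Lemma coercive_invertible T w c : bounded_operator T -> 0 < c ->
  (forall x, c * nrm x ^+ 2 <= rdot (w *: T x) x) -> invertible_operator T.
Proof.
move=> Tb c0 hT; have Tlin := bounded_lin Tb.
have wT_surj := coercive_surj (bounded_scale w Tb) c0 hT.
set m := complex.Re `|w|.
have m0 : 0 <= m by rewrite /m normc_def /= sqrtr_ge0.
(* [m + 1] instead of [m], which vanishes when [w = 0] on the zero space *)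
apply: (@bounded_below_invertible _ (c / (m + 1))) => //.
- by rewrite divr_gt0 // ltr_wpDl.
- move=> x; rewrite mulrAC ler_pdivrMr ?ltr_wpDl //.
  have [x0|x0] := eqVneq (nrm x) 0.
    by rewrite x0 mulr0 mulr_ge0 ?nrm_ge0 // addr_ge0.
  have x_gt0 : 0 < nrm x by rewrite lt_neqAle eq_sym x0 nrm_ge0.
  rewrite -(ler_pM2r x_gt0) -mulrA -expr2 (le_trans (hT x)) //.
  apply: le_trans (rdot_le _ _) _; rewrite ler_pM2r // nrmZ mulrC.
  by rewrite ler_wpM2l ?nrm_ge0 // lerDl.
- move=> y; have [x <-] := wT_surj y; exists (w *: x).
  by rewrite (linZ Tlin).
Qed.

End Coercivity.

(** * Polynomials of a self-adjoint operator *)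

Section Polynomials.
Variables (R : realType) (H : hilbertType R).
Implicit Types (x y z : H) (a c C e s : R) (w : R[i]) (S T A : H -> H).
Implicit Types (p : {poly R}) (q : {poly R[i]}).

(** Polynomials with complex coefficients, although only real ones enter the
    functional calculus: over [R[i]] they split into linear factors. *)
Definition cpoly q T x : H := \sum_(k < size q) q`_k *: iter k T x.

(** Summing over any long enough range frees the algebraic laws below from the
    degrees of sums and products. *)
Lemma cpoly_widen q T x n : (size q <= n)%N ->
  cpoly q T x = \sum_(k < n) q`_k *: iter k T x.
Proof.
move=> qn; rewrite /cpoly (big_ord_widen _ (fun k => q`_k *: iter k T x) qn).
rewrite big_mkcond; apply: eq_bigr => k _; case: ltnP => // /(nth_default 0) ->.
by rewrite scale0r.
Qed.

Lemma cpolyD q1 q2 T x : cpoly (q1 + q2) T x = cpoly q1 T x + cpoly q2 T x.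
Proof.
pose n := maxn (size q1) (size q2).
rewrite !(@cpoly_widen _ _ _ n) ?leq_maxl ?leq_maxr ?(leq_trans (size_polyD _ _)) //.
by rewrite -big_split; apply: eq_bigr => k _; rewrite coefD scalerDl.
Qed.

Lemma cpolyZ w q T x : cpoly (w *: q) T x = w *: cpoly q T x.
Proof.
rewrite (@cpoly_widen _ _ _ (size q)) ?size_scale_leq // scaler_sumr.
by apply: eq_bigr => k _; rewrite coefZ scalerA.
Qed.

Lemma cpolyC w T x : cpoly w%:P T x = w *: x.
Proof.
by rewrite (@cpoly_widen _ _ _ 1) ?size_polyC_leq1 // big_ord1 coefC.
Qed.

Lemma cpolyMX q T x : cpoly (q * 'X) T x = cpoly q T (T x).
Proof.
rewrite (@cpoly_widen _ _ _ (size q).+1); last first.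
  by rewrite (leq_trans (size_polyMleq _ _)) // size_polyX addn2.
rewrite big_ord_recl coefMX scale0r add0r.
by apply: eq_bigr => k _; rewrite coefMX /= -iterS iterSr.
Qed.

Lemma poly_operatorE p T x :
  poly_operator p T x = cpoly (map_poly (real_complex R) p) T x.
Proof.
rewrite /poly_operator fct_sumE /cpoly size_map_poly.
by apply: eq_bigr => k _; rewrite coef_map.
Qed.

Section LinearOperand.
Variables (T : H -> H) (Tlin : linear T).

Lemma cpoly_comm q x : cpoly q T (T x) = T (cpoly q T x).
Proof.
elim/poly_ind: q x => [|q w IH] x.
  by rewrite -polyC0 !cpolyC !scale0r (lin0 Tlin).
by rewrite !cpolyD !cpolyMX !cpolyC (linD Tlin) (linZ Tlin) -IH.
Qed.

Lemma cpolyM q1 q2 x : cpoly (q1 * q2) T x = cpoly q1 T (cpoly q2 T x).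
Proof.
elim/poly_ind: q1 x => [|q w IH] x; first by rewrite mul0r -polyC0 !cpolyC !scale0r.
rewrite mulrDl mulrAC mul_polyC cpolyD cpolyZ cpolyMX IH.
by rewrite cpoly_comm cpolyD cpolyMX cpolyC.
Qed.

Lemma cpoly_comp q1 q2 x : cpoly (q1 \Po q2) T x = cpoly q1 (cpoly q2 T) x.
Proof.
elim/poly_ind: q1 x => [|q w IH] x; first by rewrite comp_poly0 -polyC0 !cpolyC !scale0r.
by rewrite comp_poly_MXaddC cpolyD cpolyM IH cpolyD cpolyMX !cpolyC.
Qed.

End LinearOperand.

Lemma bounded_cpoly q T : bounded_operator T -> bounded_operator (cpoly q T).
Proof.
move=> Tb; elim/poly_ind: q => [|q w IH].
  have -> : cpoly 0 T = 0 :> (H -> H).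
    by apply/funext => x; rewrite -polyC0 cpolyC scale0r.
  exact: bounded0.
have -> : cpoly (q * 'X + w%:P) T = cpoly q T \o T + w *: (id : H -> H).
  by apply/funext => x; rewrite cpolyD cpolyMX cpolyC.
by apply: bounded_add; [exact: bounded_comp|exact: bounded_scale (bounded_id _)].
Qed.

Lemma bounded_poly p T : bounded_operator T -> bounded_operator (poly_operator p T).
Proof.
move=> /(bounded_cpoly (map_poly (real_complex R) p)) Tb.
suff -> : poly_operator p T = cpoly (map_poly (real_complex R) p) T by [].
by apply/funext => x; exact: poly_operatorE.
Qed.

Lemma poly_opD p1 p2 T x :
  poly_operator (p1 + p2) T x = poly_operator p1 T x + poly_operator p2 T x.
Proof. by rewrite !poly_operatorE rmorphD cpolyD. Qed.

Lemma poly_opZ a p T x : poly_operator (a *: p) T x = a%:C *: poly_operator p T x.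
Proof. by rewrite !poly_operatorE linearZ cpolyZ. Qed.

Lemma poly_opN p T x : poly_operator (- p) T x = - poly_operator p T x.
Proof. by rewrite -scaleN1r poly_opZ rmorphN scaleN1r. Qed.

Lemma poly_opC a T x : poly_operator a%:P T x = a%:C *: x.
Proof. by rewrite !poly_operatorE map_polyC cpolyC. Qed.

Lemma poly_opMX p T x : poly_operator (p * 'X) T x = poly_operator p T (T x).
Proof. by rewrite !poly_operatorE rmorphM /= map_polyX cpolyMX. Qed.

Lemma poly_opM p1 p2 T x : linear T ->
  poly_operator (p1 * p2) T x = poly_operator p1 T (poly_operator p2 T x).
Proof. by move=> Tlin; rewrite !poly_operatorE rmorphM cpolyM. Qed.

Lemma poly_op_comp p1 p2 T x : linear T ->
  poly_operator (p1 \Po p2) T x = poly_operator p1 (poly_operator p2 T) x.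
Proof.
move=> Tlin; rewrite !poly_operatorE map_comp_poly cpoly_comp //.
by congr cpoly; apply/funext => y; rewrite poly_operatorE.
Qed.

Lemma selfadjoint_poly p T : linear T -> selfadjoint T -> selfadjoint (poly_operator p T).
Proof.
move=> Tlin Ts; elim/poly_ind: p => [|p c IH] x y.
  by rewrite -polyC0 !poly_opC rdotZl rdotZr.
rewrite !poly_opD !poly_opMX !poly_opC rdotDl rdotDr rdotZl rdotZr IH Ts.
by rewrite !poly_operatorE cpoly_comm.
Qed.

Lemma invertible_comp S T :
  invertible_operator S -> invertible_operator T -> invertible_operator (S \o T).
Proof.
move=> [S' [S'b SS' S'S]] [T' [T'b TT' T'T]]; exists (T' \o S').
split; first exact: bounded_comp.
  by apply/funext => x; have /= -> := congr1 (@^~ (S' x)) TT'; have := congr1 (@^~ x) SS'.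
by apply/funext => x; have /= -> := congr1 (@^~ (T x)) S'S; have := congr1 (@^~ x) T'T.
Qed.

Lemma invertible_scale w : w != 0 -> invertible_operator (w *: (id : H -> H)).
Proof.
move=> w0; exists (w^-1 *: id); split; first exact: bounded_scale (bounded_id _).
  by apply/funext => x /=; rewrite !fctE scalerA mulfV // scale1r.
by apply/funext => x /=; rewrite !fctE scalerA mulVf // scale1r.
Qed.

(** Off the real axis, multiplying [T - w] by ['i * Im w] makes it coercive:
    the symmetric part contributes nothing to the real part. *)
Lemma resolvent_invertible T w : bounded_operator T -> selfadjoint T ->
  (complex.Im w = 0 -> ~ real_spectrum T (complex.Re w)) ->
  invertible_operator (T - w *: (id : H -> H)).
Proof.
move=> Tb Ts hw; have [Imw0|Imw0] := eqVneq (complex.Im w) 0.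
  have /contrapT := hw Imw0; congr (invertible_operator (T - _)).
  by apply/funext => x; rewrite /scalar_operator {2}[w]complexE Imw0 mulr0 addr0.
apply: (@coercive_invertible _ _ _ ('i * (complex.Im w)%:C) (complex.Im w ^+ 2)).
- exact: bounded_sub Tb (bounded_scale _ (bounded_id _)).
- by rewrite lt_neqAle eq_sym sqrf_eq0 Imw0 sqr_ge0.
move=> x; rewrite -scalerA rdot_iZl.
have -> : hdot ((complex.Im w)%:C *: (T - w *: (id : H -> H)) x) x =
    (complex.Im w)%:C * (hdot (T x) x - w * (nrm x ^+ 2)%:C).
  by rewrite rmorphXn /= -normE hdotE linearZl_LR linearBl linearZl_LR.
have := selfadjoint_Im0 x (bounded_lin Tb) Ts.
case: (hdot (T x) x) => u v /= ->.
case: w {hw} Imw0 => wr wi /= _; lra.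
Qed.

(** The half of the spectral mapping theorem that is needed: [q(T)] is a product
    of resolvent factors [T - z] over the roots [z] of [q], none of which lies in
    the spectrum. *)
Lemma cpoly_invertible q T : bounded_operator T -> selfadjoint T -> q != 0 ->
  (forall t, real_spectrum T t -> q.[t%:C] != 0) -> invertible_operator (cpoly q T).
Proof.
move=> Tb Ts q0 hq; have [r qE] := closed_field_poly_normal q.
have hr w : w \in r -> complex.Im w = 0 -> ~ real_spectrum T (complex.Re w).
  move=> wr Imw /hq; have -> : (complex.Re w)%:C = w.
    by rewrite [RHS]complexE Imw mulr0 addr0.
  rewrite qE hornerZ mulf_eq0 negb_or => /andP[_].
  by rewrite -/(root _ _) root_prod_XsubC wr.
rewrite qE; have -> : cpoly (lead_coef q *: \prod_(z <- r) ('X - z%:P)) T =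
    (lead_coef q *: (id : H -> H)) \o cpoly (\prod_(z <- r) ('X - z%:P)) T.
  by apply/funext => x; rewrite cpolyZ.
apply: invertible_comp; first by apply: invertible_scale; rewrite lead_coef_eq0.
elim: r hr {qE} => [_|w r IH hr].
  rewrite big_nil; have -> : cpoly 1 T = 1 *: (id : H -> H).
    by apply/funext => x; rewrite -polyC1 cpolyC.
  exact: invertible_scale (oner_neq0 _).
rewrite big_cons; set s := \prod_(z <- r) _.
have -> : cpoly (('X - w%:P) * s) T = (T - w *: (id : H -> H)) \o cpoly s T.
  apply/funext => x; rewrite cpolyM; last exact: bounded_lin.
  by rewrite -[X in X - _]mul1r -polyCN cpolyD cpolyMX !cpolyC scale1r scaleNr.
apply: invertible_comp; last by apply: IH => z zr; apply: hr; rewrite inE zr orbT.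
by apply: resolvent_invertible => //; apply: hr; rewrite inE eqxx.
Qed.

(** If [K] bounds the inverse and [C] bounds [A], Cauchy-Schwarz for the form of
    [A] gives [|A x|^2 <= C <A x, x>], whence [|x|^2 <= K^2 C <A x, x>].  The
    constant used is the inverse of [K^2 C + 1], as [K^2 C] may be zero. *)
Lemma pos_invertible_below A : bounded_operator A -> selfadjoint A ->
  (forall x, 0 <= rdot (A x) x) -> invertible_operator A ->
  exists2 c, 0 < c & forall x, c * nrm x ^+ 2 <= rdot (A x) x.
Proof.
move=> Ab As Apos [S [/bounded_operatorP[_ [K K0 hK]] _ SA]].
have Alin := bounded_lin Ab.
have /bounded_operatorP[_ [C C0 hC]] := Ab.
have D0 : 0 < K ^+ 2 * C + 1 by rewrite ltr_wpDl // mulr_ge0 ?sqr_ge0.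
exists (K ^+ 2 * C + 1)^-1 => [|x]; first by rewrite invr_gt0.
rewrite mulrC ler_pdivrMr //.
have AxC : nrm (A x) ^+ 2 <= C * rdot (A x) x.
  have [->|Ax0] := eqVneq (nrm (A x)) 0; first by rewrite expr0n mulr_ge0.
  have Ax_gt0 : 0 < nrm (A x) ^+ 2 by rewrite exprn_gt0 // lt_neqAle eq_sym Ax0 nrm_ge0.
  have := pos_form_CS x (A x) Alin As Apos; rewrite rdotxx => h.
  rewrite -(ler_pM2r Ax_gt0) -expr2 (le_trans h) // (mulrC C) -mulrA ler_wpM2l //.
  by rewrite (le_trans (rdot_le _ _)) // expr2 mulrA ler_wpM2r ?nrm_ge0.
have xK : nrm x ^+ 2 <= K ^+ 2 * nrm (A x) ^+ 2.
  rewrite -exprMn ler_sqr ?nnegrE ?mulr_ge0 ?nrm_ge0 //.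
  by have := hK (A x); have /= -> := congr1 (@^~ x) SA.
rewrite mulrDr mulr1 (mulrC _ (K ^+ 2 * C)) -mulrA.
apply: le_trans xK _; apply: le_trans (ler_wpM2l (sqr_ge0 K) AxC) _.
by rewrite lerDl.
Qed.

(** If the infimum [m] of the quadratic form of [A] were negative, [A - m]
    would be positive and invertible, hence bounded below by some [c > 0], and
    [m + c] would be a larger lower bound. *)
Lemma pos_of_invertible A : bounded_operator A -> selfadjoint A ->
  (forall s, 0 < s -> invertible_operator (A + scalar_operator s)) ->
  forall x, 0 <= rdot (A x) x.
Proof.
move=> Ab As Ainv x0; rewrite leNgt; apply/negP => Ax0.
pose E := [set m : R | forall x, m * nrm x ^+ 2 <= rdot (A x) x].
have Elt0 m : E m -> m < 0.
  move=> /(_ x0) h; rewrite ltNge; apply/negP => m0.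
  by have := mulr_ge0 m0 (sqr_ge0 (nrm x0)); lra.
have supE : has_sup E.
  split; last by exists 0 => m /Elt0 /ltW.
  have /bounded_operatorP[_ [C C0 hC]] := Ab.
  exists (- C) => x; have := rdot_le (- A x) x; rewrite rdotNl nrmN => h.
  rewrite mulNr lerNl (le_trans h) // expr2 mulrA ler_wpM2r ?nrm_ge0 //.
(* lower bounds of the quadratic form are closed under suprema *)
have Esup : E (sup E).
  move=> x; apply/ler_addgt0Pl => e e0.
  have N0 : 0 < nrm x ^+ 2 + 1 by rewrite ltr_wpDl // sqr_ge0.
  have [m Em hm] := sup_adherent (divr_gt0 e0 N0) supE.
  have h1 : sup E * nrm x ^+ 2 <= (m + e / (nrm x ^+ 2 + 1)) * nrm x ^+ 2.
    by rewrite ler_wpM2r ?sqr_ge0 // -lerBlDr ltW.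
  have h2 : e / (nrm x ^+ 2 + 1) * nrm x ^+ 2 <= e.
    by rewrite mulrAC ler_pdivrMr // ler_wpM2l ?(ltW e0) // lerDl.
  apply: le_trans h1 _; rewrite mulrDl; have := Em x; lra.
have s0 : 0 < - sup E by rewrite oppr_gt0; exact: Elt0.
have [||||c c0 hc] := @pos_invertible_below (A + scalar_operator (- sup E)).
- exact: bounded_add Ab (bounded_scalar _ _).
- by move=> x y; rewrite !fctE /scalar_operator rdotDl rdotDr rdotZl rdotZr As.
- move=> x; rewrite !fctE /scalar_operator rdotDl rdotZl rdotxx.
  by have := Esup x; lra.
- exact: Ainv.
have : E (sup E + c).
  move=> x; have := hc x; rewrite !fctE /scalar_operator rdotDl rdotZl rdotxx.
  lra.
move=> /(ub_le_sup supE.2); lra.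
Qed.

(** For [s > 0] the polynomial [p + s] does not vanish on the spectrum, so
    [p(T) + s] is invertible by [cpoly_invertible], which asks for a nonzero
    polynomial; then [pos_of_invertible] applies. *)
Lemma nonconstant_poly_pos p T : bounded_operator T -> selfadjoint T ->
  (forall s, p + s%:P != 0) ->
  (forall t, real_spectrum T t -> 0 <= p.[t]) ->
  forall x, 0 <= rdot (poly_operator p T x) x.
Proof.
move=> Tb Ts pN hp; apply: pos_of_invertible.
- exact: bounded_poly.
- exact: selfadjoint_poly (bounded_lin Tb) Ts.
move=> s s0; set q := map_poly (real_complex R) (p + s%:P).
have -> : poly_operator p T + scalar_operator s = cpoly q T.
  by apply/funext => x; rewrite -poly_operatorE poly_opD poly_opC.
apply: cpoly_invertible => // [|t /hp pt]; first by rewrite map_poly_eq0.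
by rewrite /q horner_map fmorph_eq0 hornerD hornerC gt_eqF // ltr_wpDl.
Qed.

(** For a constant polynomial the hypothesis says nothing if the spectrum is
    empty; that only happens on the zero space, where every operator is
    positive. *)
Lemma poly_pos p T : bounded_operator T -> selfadjoint T ->
  (forall t, real_spectrum T t -> 0 <= p.[t]) ->
  forall x, 0 <= rdot (poly_operator p T x) x.
Proof.
move=> Tb Ts hp; have [[s ps]|pN] := pselect (exists s, p + s%:P = 0); last first.
  by apply: nonconstant_poly_pos => // s; apply/eqP => ps; apply: pN; exists s.
have pE : p = (- s)%:P by rewrite polyCN; apply/eqP; rewrite -addr_eq0 ps.
move=> x; rewrite pE poly_opC rdotZl rdotxx.
have [[t /hp]|sp0] := pselect (exists t, real_spectrum T t).
  by rewrite pE hornerC => s0; rewrite mulr_ge0 ?sqr_ge0.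
have /bounded_operatorP[_ [C C0 hC]] := Tb.
suff -> : nrm x = 0 by rewrite expr0n mulr0.
(* with an empty spectrum [T - (C + 1)] would be positive too, which forces
   [x = 0] as [C] bounds [T] *)
have : 0 <= rdot (poly_operator ('X + (- (C + 1))%:P) T x) x.
  apply: nonconstant_poly_pos => // [s'|t st]; last by case: sp0; exists t.
  rewrite -addrA -polyCD; apply/eqP => /(congr1 (fun r : {poly R} => size r)).
  by rewrite size_XaddC size_poly0.
rewrite -['X]mul1r poly_opD poly_opMX -polyC1 !poly_opC scale1r rdotDl rdotZl rdotxx.
have h := rdot_le (T x) x; have h' := ler_wpM2r (nrm_ge0 x) (hC x).
move=> h2; apply/eqP; rewrite -sqrf_eq0 eq_le sqr_ge0 andbT.
by rewrite expr2 in h2 *; lra.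
Qed.

(** Positivity of [e^2 - p^2] on the spectrum gives [|p(T) x|^2 <= e^2 |x|^2],
    because [p(T)] is self-adjoint. *)
Lemma poly_norm_le p T e : bounded_operator T -> selfadjoint T -> 0 <= e ->
  (forall t, real_spectrum T t -> `|p.[t]| <= e) ->
  forall x, nrm (poly_operator p T x) <= e * nrm x.
Proof.
move=> Tb Ts e0 hp x; have Tlin := bounded_lin Tb.
have := @poly_pos ((e ^+ 2)%:P - p * p) T Tb Ts.
have H1 t : real_spectrum T t -> 0 <= ((e ^+ 2)%:P - p * p).[t].
  move=> /hp h; rewrite !hornerE subr_ge0 -expr2 -[leLHS]real_normK ?num_real //.
  by rewrite ler_sqr ?nnegrE ?normr_ge0.
move=> /(_ H1 x); rewrite poly_opD poly_opN poly_opC poly_opM //.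
rewrite rdotDl rdotNl rdotZl rdotxx (selfadjoint_poly _ Tlin Ts) rdotxx subr_ge0 -exprMn.
by rewrite ler_sqr ?nnegrE ?mulr_ge0 ?nrm_ge0.
Qed.

End Polynomials.

(** * Continuous functional calculus *)

Section Calculus.
Variables (R : realType) (H : hilbertType R).
Implicit Types (x y z : H) (a c C e s : R) (S T A : H -> H).
Implicit Types (p : {poly R}) (f g : R -> R).

Lemma nrm_le_opnorm A x : bounded_operator A -> nrm (A x) <= opnorm A * nrm x.
Proof.
move=> /bounded_operatorP[Alin [C C0 hC]].
have [/nrm_eq0 ->|x0] := eqVneq (nrm x) 0.
  by rewrite (lin0 Alin) nrm0 mulr0.
have x_gt0 : 0 < nrm x by rewrite lt_neqAle eq_sym x0 nrm_ge0.
rewrite -ler_pdivrMr // mulrC.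
have -> : (nrm x)^-1 * nrm (A x) = nrm (A ((nrm x)^-1%:C *: x)).
  by rewrite (linZ Alin) nrmZr ger0_norm // invr_ge0 nrm_ge0.
apply: ub_le_sup; last first.
  exists ((nrm x)^-1%:C *: x) => //=.
  by rewrite normE lecR nrmZr ger0_norm ?invr_ge0 ?nrm_ge0 // mulVf.
exists C => _ [y /= y1 <-]; apply: le_trans (hC y) _.
by move: y1; rewrite normE lecR => /(ler_wpM2l C0); rewrite mulr1.
Qed.

Lemma opnorm_le A e : 0 <= e -> (forall x, nrm (A x) <= e * nrm x) -> opnorm A <= e.
Proof.
move=> e0 hA; apply: ge_sup.
  by exists (nrm (A 0)), 0 => //=; rewrite normr0.
move=> _ [x /= x1 <-]; apply: le_trans (hA x) _.
by move: x1; rewrite normE lecR => /(ler_wpM2l e0); rewrite mulr1.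
Qed.

Lemma opnorm_ge0 A : bounded_operator A -> 0 <= opnorm A.
Proof.
move=> Ab; have /bounded_operatorP[Alin [C C0 hC]] := Ab.
apply: ub_le_sup; last by exists 0 => /=; rewrite ?normr0 // (lin0 Alin) normr0.
exists C => _ [y /= y1 <-]; apply: le_trans (hC y) _.
by move: y1; rewrite normE lecR => /(ler_wpM2l C0); rewrite mulr1.
Qed.

Lemma uniform_hornerP (X : set R) (p : nat -> {poly R}) f :
  {uniform X, (fun k t => (p k).[t]) @ \oo --> f} <->
  forall e, 0 < e -> \forall k \near \oo, forall t, X t -> `|f t - (p k).[t]| < e.
Proof.
split=> [h e e0|h].
  apply: (h [set g : {uniform` X -> R} | forall t, X t -> `|f t - g t| < e]).
  apply/uniform_nbhs; exists [set xy | `|xy.1 - xy.2| < e]; split=> //.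
  by rewrite -entourage_ballE; exists e => //= -[u v]; rewrite -ball_normE.
move=> P /uniform_nbhs[E [entE EP]].
move: entE; rewrite -entourage_ballE => -[e /= e0 hE].
near=> k; apply: EP => t Xt; apply: hE => /=; rewrite -ball_normE /=.
by move: t Xt; near: k; exact: h.
Unshelve. all: by end_near. Qed.

(** An epsilon form of [is_cfc], with one polynomial at each precision in place
    of a sequence, and pointwise bounds in place of the operator norm. *)
Definition has_cfc f T S := bounded_operator S /\
  forall e, 0 < e -> exists p,
    (forall t, real_spectrum T t -> `|p.[t] - f t| <= e) /\
    forall x, nrm (poly_operator p T x - S x) <= e * nrm x.

Lemma has_cfcP f T S : bounded_operator T -> is_cfc f T S <-> has_cfc f T S.
Proof.
move=> Tb; split=> [[Sb [p [/uniform_hornerP pf pS]]]|[Sb h]]; split=> //.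
  move=> e e0.
  have /cvgrPdist_le/(_ e e0) := pS.
  move=> h2; have h1 := pf e e0.
  have [k [hk1 hk2]] : exists k, (forall t, real_spectrum T t -> `|f t - (p k).[t]| < e)
      /\ `|0 - opnorm (poly_operator (p k) T - S)| <= e.
    by near \oo => k; exists k; split; near: k.
  exists (p k); split=> [t /hk1|x]; first by rewrite distrC => /ltW.
  have pb := bounded_sub (bounded_poly (p k) Tb) Sb.
  apply: le_trans (nrm_le_opnorm x pb) _; rewrite ler_wpM2r ?nrm_ge0 //.
  by move: hk2; rewrite sub0r normrN ger0_norm // opnorm_ge0.
have /choice[p hp] : forall k : nat, exists p,
    (forall t, real_spectrum T t -> `|p.[t] - f t| <= k.+1%:R^-1) /\
    forall x, nrm (poly_operator p T x - S x) <= k.+1%:R^-1 * nrm x.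
  by move=> k; apply: h; rewrite invr_gt0.
exists p; split.
  apply/uniform_hornerP => e e0; near=> k => t /(hp k).1.
  rewrite distrC => /le_lt_trans; apply.
  by near: k; exact: near_infty_natSinv_lt (PosNum e0).
apply/cvgrPdist_le => e e0; near=> k.
have pb := bounded_sub (bounded_poly (p k) Tb) Sb.
rewrite sub0r normrN ger0_norm ?opnorm_ge0 //.
apply: le_trans (opnorm_le _ (hp k).2) _; first by rewrite invr_ge0.
by apply: ltW; near: k; exact: near_infty_natSinv_lt (PosNum e0).
Unshelve. all: by end_near. Qed.

Lemma small_factor c e : 0 <= c -> 0 < e -> exists2 d, 0 < d & d * c <= e.
Proof.
move=> c0 e0; have c1 : 0 < c + 1 by rewrite ltr_wpDl.
exists (e / (c + 1)); first exact: divr_gt0.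
by rewrite mulrAC ler_pdivrMr // ler_wpM2l ?(ltW e0) // lerDl.
Qed.

(** The functional calculus is determined by [f] on the spectrum because
    [p |-> p(T)] contracts the supremum norm over the spectrum. *)
Lemma has_cfc_approx f T S p e : bounded_operator T -> selfadjoint T -> has_cfc f T S -> 0 <= e ->
  (forall t, real_spectrum T t -> `|p.[t] - f t| <= e) ->
  forall x, nrm (poly_operator p T x - S x) <= e * nrm x.
Proof.
move=> Tb Ts [_ hS] e0 hp x; apply/ler_addgt0Pr => d d0.
have [c c0 hc] := small_factor (mulr_ge0 (ler0n R 2) (nrm_ge0 x)) d0.
have [q [qf qS]] := hS _ c0.
have pq : nrm (poly_operator (p - q) T x) <= (e + c) * nrm x.
  apply: poly_norm_le => // [|t st]; first by rewrite addr_ge0 // ltW.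
  rewrite hornerD hornerN -(subrKA (f t)) (le_trans (ler_normD _ _)) //.
  by rewrite lerD ?hp // distrC qf.
rewrite poly_opD poly_opN in pq.
have := nrm_triangle (poly_operator p T x) (poly_operator q T x) (S x).
by have := qS x; lra.
Qed.

Lemma has_cfc_unique f T S S' : bounded_operator T -> selfadjoint T ->
  has_cfc f T S -> has_cfc f T S' -> S = S'.
Proof.
move=> Tb Ts hS hS'; apply/funext => x; apply: subr0_eq.
apply: nrm_le0_eps => e e0.
have [d d0 hd] := small_factor (mulr_ge0 (ler0n R 2) (nrm_ge0 x)) e0.
have [p [pf pS]] := hS.2 _ d0.
have pS' := has_cfc_approx Tb Ts hS' (ltW d0) pf.
have := nrm_triangle (S x) (poly_operator p T x) (S' x).
by rewrite (nrm_distC (S x) (poly_operator p T x)); have := pS x; have := pS' x; lra.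
Qed.

Lemma cfc_eq f T S : bounded_operator T -> selfadjoint T -> has_cfc f T S -> cfc f T = S.
Proof.
move=> Tb Ts hS; apply: xget_unique; first exact/has_cfcP.
by move=> S' /(has_cfcP _ _ Tb) hS'; exact: has_cfc_unique hS' hS.
Qed.

(** [S - L] is small in norm for some linear [L], so the defect of linearity of
    [S], which equals that of [S - L], is arbitrarily small. *)
Lemma linear_limit S :
  (forall e, 0 < e -> exists2 L, linear L & forall x, nrm (L x - S x) <= e * nrm x) ->
  linear S.
Proof.
move=> hS b x y; apply: subr0_eq; apply: nrm_le0_eps => e e0.
pose N := nrm (b *: x + y) + complex.Re `|b| * nrm x + nrm y.
have b0 : 0 <= complex.Re `|b| by rewrite normc_def /= sqrtr_ge0.
have N0 : 0 <= N by rewrite !addr_ge0 ?mulr_ge0 ?nrm_ge0.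
have [d d0 hd] := small_factor N0 e0; have [L Llin hL] := hS _ d0.
have -> : S (b *: x + y) - (b *: S x + S y) =
    - (L (b *: x + y) - S (b *: x + y)) + (b *: (L x - S x) + (L y - S y)).
  by rewrite Llin scalerBr opprB (addrACA (b *: L x)) -opprD addrA subrK.
apply: le_trans (nrmD _ _) _; rewrite nrmN.
have := nrmD (b *: (L x - S x)) (L y - S y); rewrite nrmZ.
have := ler_wpM2l b0 (hL x); have := hL y; have := hL (b *: x + y).
by move: hd; rewrite /N; lra.
Qed.

(** Polynomials that converge uniformly on the spectrum have values at [T] that
    form a Cauchy sequence at each vector, with a rate that is uniform on bounded
    sets; the pointwise limit is therefore a limit in operator norm. *)
Lemma has_cfc_exists f T : bounded_operator T -> selfadjoint T ->
  (forall e, 0 < e -> exists p, forall t, real_spectrum T t -> `|p.[t] - f t| <= e) ->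
  exists S, has_cfc f T S.
Proof.
move=> Tb Ts hf.
have /choice[p hp] : forall k : nat, exists p,
    forall t, real_spectrum T t -> `|p.[t] - f t| <= k.+1%:R^-1.
  by move=> k; apply: hf; rewrite invr_gt0.
have Cauchy x N k : (N <= k)%N ->
    nrm (poly_operator (p N) T x - poly_operator (p k) T x) <= 2 * N.+1%:R^-1 * nrm x.
  move=> Nk; rewrite -poly_opN -poly_opD; apply: poly_norm_le => // t st.
  have kN : k.+1%:R^-1 <= N.+1%:R^-1 :> R by rewrite lef_pV2 ?posrE // ler_nat.
  rewrite hornerD hornerN -(subrKA (f t)) (le_trans (ler_normD _ _)) //.
  have := hp N t st; have := hp k t st; rewrite [`|f t - _|]distrC.
  move: kN; move: N.+1%:R^-1 k.+1%:R^-1 => u v; lra.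
have approx e : 0 < e -> exists k : nat, 2 * k.+1%:R^-1 <= e.
  move=> e0; have d0 : 0 < e / 2 by exact: divr_gt0.
  have [N _ /(_ N (leqnn N)) /= hN] := near_infty_natSinv_lt (PosNum d0).
  by exists N; move: hN => /=; move: N.+1%:R^-1 => u; lra.
have /choice[S hS] : forall x, exists l, forall e, 0 < e ->
    exists N, forall k, (N <= k)%N -> nrm (l - poly_operator (p k) T x) <= e.
  move=> x; apply: cauchy_limit => e e0.
  have [d /approx[N hN] hd] := small_factor (nrm_ge0 x) e0; exists N => k /(Cauchy x) h.
  by apply: le_trans h _; apply: le_trans hd; rewrite ler_wpM2r ?nrm_ge0.
have rate x k : nrm (poly_operator (p k) T x - S x) <= 2 * k.+1%:R^-1 * nrm x.
  apply/ler_addgt0Pr => e /(hS x)[N hN].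
  apply: le_trans (nrm_triangle _ (poly_operator (p (maxn k N)) T x) _) _.
  by rewrite lerD ?Cauchy ?leq_maxl // nrm_distC hN // leq_maxr.
exists S; split.
  apply/bounded_operatorP; split.
    apply: linear_limit => e /approx[k hk].
    exists (poly_operator (p k) T); first exact: bounded_lin (bounded_poly _ Tb).
    by move=> x; rewrite (le_trans (rate x k)) // ler_wpM2r ?nrm_ge0.
  have /bounded_operatorP[_ [C C0 hC]] := bounded_poly (p 0) Tb.
  exists (C + 2) => [|x]; first by rewrite addr_ge0.
  have := rate x 0; rewrite invr1 mulr1 => h.
  have := nrm_triangle (S x) (poly_operator (p 0) T x) 0; rewrite !subr0.
  by rewrite nrm_distC; have := hC x; lra.
move=> e /approx[k hk]; exists (p k); split=> [t st|x].
  apply: le_trans (hp k t st) _; apply: le_trans hk.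
  have : 0 <= k.+1%:R^-1 :> R by rewrite invr_ge0.
  by move: k.+1%:R^-1 => u; lra.
by rewrite (le_trans (rate x k)) // ler_wpM2r ?nrm_ge0.
Qed.

Lemma has_cfc_poly p T : bounded_operator T -> has_cfc (horner p) T (poly_operator p T).
Proof.
move=> Tb; split=> [|e e0]; first exact: bounded_poly.
exists p; split=> [t _|x]; first by rewrite subrr normr0 ltW.
by rewrite subrr nrm0 mulr_ge0 ?nrm_ge0 // ltW.
Qed.

Lemma has_cfcD f g T S S' : has_cfc f T S -> has_cfc g T S' ->
  has_cfc (fun t => f t + g t) T (S + S').
Proof.
move=> [Sb hS] [S'b hS']; split=> [|e e0]; first exact: bounded_add.
have d0 : 0 < e / 2 by exact: divr_gt0.
have [p [pf pS]] := hS _ d0; have [q [qf qS]] := hS' _ d0.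
exists (p + q); split=> [t st|x].
  rewrite hornerD opprD addrACA (le_trans (ler_normD _ _)) //.
  by have := pf t st; have := qf t st; lra.
rewrite poly_opD !fctE opprD addrACA (le_trans (nrmD _ _)) //.
by have := pS x; have := qS x; lra.
Qed.

Lemma has_cfcZ a f T S : has_cfc f T S -> has_cfc (fun t => a * f t) T (a%:C *: S).
Proof.
move=> [Sb hS]; split=> [|e e0]; first exact: bounded_scale.
have a1 : 0 < `|a| + 1 by rewrite ltr_wpDl.
have [p [pf pS]] := hS _ (divr_gt0 e0 a1).
have ae : `|a| * (e / (`|a| + 1)) <= e.
  by rewrite mulrA ler_pdivrMr // mulrC ler_wpM2l ?(ltW e0) // lerDl.
exists (a *: p); split=> [t st|x].
  by rewrite hornerZ -mulrBr normrM (le_trans _ ae) // ler_wpM2l // pf.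
rewrite poly_opZ !fctE -scalerBr nrmZr.
apply: le_trans (ler_wpM2l (normr_ge0 a) (pS x)) _.
by rewrite mulrA ler_wpM2r ?nrm_ge0.
Qed.

Lemma has_cfc_ext f g T S : (forall t, real_spectrum T t -> f t = g t) ->
  has_cfc f T S -> has_cfc g T S.
Proof.
move=> fg [Sb hS]; split=> // e /hS[p [pf pS]]; exists p; split=> // t st.
by rewrite -fg // pf.
Qed.

(** Self-adjointness and positivity are inherited from the approximating
    polynomials [p(T)] and [(p + d)(T)], where [p] is within [d] of [f]. *)
Lemma has_cfc_pos f T S : bounded_operator T -> selfadjoint T -> has_cfc f T S ->
  (forall t, real_spectrum T t -> 0 <= f t) -> positive_operator S.
Proof.
move=> Tb Ts [Sb hS] f0; have Tlin := bounded_lin Tb.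
apply/positive_operatorP; split=> // [x y|x].
  have le_sym u v : rdot (S u) v <= rdot u (S v).
    apply/ler_addgt0Pr => e e0.
    have uv0 : 0 <= 2 * (nrm u * nrm v) by rewrite !mulr_ge0 ?nrm_ge0.
    have [d d0 hd] := small_factor uv0 e0.
    have [p [_ pS]] := hS _ d0.
    have := selfadjoint_poly p Tlin Ts u v.
    have := rdot_le (- (poly_operator p T u - S u)) v.
    have := rdot_le u (poly_operator p T v - S v).
    rewrite nrmN rdotNl rdotDl rdotNl rdotDr rdotNr.
    have := ler_wpM2r (nrm_ge0 v) (pS u); have := ler_wpM2l (nrm_ge0 u) (pS v).
    lra.
  apply/eqP; rewrite eq_le le_sym /=.
  by have := le_sym y x; rewrite (rdotC (S y)) (rdotC y).
rewrite -oppr_le0; apply/ler_addgt0Pr => e e0; rewrite add0r.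
have x0 : 0 <= 2 * (nrm x * nrm x) by rewrite !mulr_ge0 ?nrm_ge0.
have [d d0 hd] := small_factor x0 e0.
have [p [pf pS]] := hS _ d0.
have := @poly_pos _ _ (p + d%:P) T Tb Ts.
have pd t : real_spectrum T t -> 0 <= (p + d%:P).[t].
  move=> st; rewrite hornerD hornerC; have := f0 t st.
  by have := pf t st; rewrite ler_norml => /andP[]; lra.
move=> /(_ pd x); rewrite poly_opD poly_opC rdotDl rdotZl rdotxx expr2.
have := rdot_le (poly_operator p T x - S x) x; rewrite rdotDl rdotNl.
by have := ler_wpM2r (nrm_ge0 x) (pS x); lra.
Qed.

End Calculus.

(** * Weierstrass approximation by Bernstein polynomials *)

Section Weierstrass.
Variable R : realType.
Implicit Types (x y t a b c e v : R) (g : R -> R) (h : nat -> R).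

(** The Bernstein polynomial of the values [h 0, ..., h n], by first-step
    analysis of the binomial distribution: its value at [x] is the expectation of
    [h] at the number of successes in [n] trials of probability [x]. *)
Fixpoint bernstein (n : nat) h : {poly R} :=
  if n is m.+1 then (1 - 'X) * bernstein m h + 'X * bernstein m (h \o S)
  else (h 0)%:P.

(** The right-hand side is the expectation of [a + b (k - c)^2]: the binomial
    distribution has mean [n x] and variance [n x (1 - x)].  Allowing any centre
    [c] makes the induction go through, as a first success shifts it by 1. *)
Lemma bernstein_dist n h v a b c x : 0 <= x <= 1 ->
  (forall k, (k <= n)%N -> `|h k - v| <= a + b * (k%:R - c) ^+ 2) ->
  `|(bernstein n h).[x] - v| <= a + b * ((n%:R * x - c) ^+ 2 + n%:R * x * (1 - x)).
Proof.
move=> /andP[x0 x1]; elim: n h c => [|n IH] h c hk.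
  by have := hk 0 (leqnn 0); rewrite /= hornerC !mul0r addr0.
have h1 := IH h c (fun k kn => hk k (leqW kn)).
have h2 : `|(bernstein n (h \o S)).[x] - v| <=
    a + b * ((n%:R * x - (c - 1)) ^+ 2 + n%:R * x * (1 - x)).
  apply: IH => k kn; have := hk k.+1 kn; rewrite -natr1 /=.
  by rewrite opprB addrA.
rewrite /= hornerD !hornerM hornerD hornerN hornerX hornerC.
have -> : (1 - x) * (bernstein n h).[x] + x * (bernstein n (h \o S)).[x] - v =
    (1 - x) * ((bernstein n h).[x] - v) + x * ((bernstein n (h \o S)).[x] - v).
  by ring.
apply: le_trans (ler_normD _ _) _; rewrite !normrM (ger0_norm x0) ger0_norm ?subr_ge0 //.
have x1' : 0 <= 1 - x by rewrite subr_ge0.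
have := lerD (ler_wpM2l x1' h1) (ler_wpM2l x0 h2); congr (_ <= _).
by rewrite -natr1; ring.
Qed.

Lemma uniform_continuity g a b e : {within `[a, b], continuous g} -> 0 < e ->
  exists2 d, 0 < d & forall x y, a <= x <= b -> a <= y <= b ->
    `|x - y| < d -> `|g x - g y| <= e.
Proof.
move=> /subspace_continuousP gc e0.
have /compact_near_coveringP := @segment_compact R a b.
move=> /(_ R (0^'+) (fun d x => a <= x <= b -> forall y, a <= y <= b ->
  `|x - y| < d -> `|g x - g y| <= e)) [].
  move=> x xab; have := gc x xab.
  move=> /cvgrPdist_lt/(_ (e / 2) (divr_gt0 e0 (ltr0n _ 2))).
  rewrite /= near_withinE => /nbhs_ballP[r /= r0 hr].
  have r2 : 0 < r / 2 by exact: divr_gt0.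
  exists (ball x (r / 2), [set d | d < r / 2]) => /=.
    by split; [exact: nbhsx_ballx|exact: nbhs_right_lt].
  move=> [x' d] /= [xx' dr] x'ab y yab x'y.
  have xx'2 : `|x - x'| < r / 2 by move: xx'; rewrite -ball_normE.
  have h1 : `|g x - g x'| < e / 2.
    apply: hr; last by rewrite /= in_itv.
    by rewrite -ball_normE /=; lra.
  have h2 : `|g x - g y| < e / 2.
    apply: hr; last by rewrite /= in_itv.
    rewrite -ball_normE /= -(subrKA x') (le_lt_trans (ler_normD _ _)) //; lra.
  by rewrite -(subrKA (g x)) (le_trans (ler_normD _ _)) // distrC; lra.
move=> d /= d0 hd; exists (d / 2); first exact: divr_gt0.
move=> x y xab yab xy; apply: (hd (d / 2)) => //=.
  by rewrite sub0r normrN ger0_norm; lra.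
by lra.
Qed.

(** The form in which uniform continuity meets a variance estimate: far from the
    diagonal the quadratic term alone exceeds the oscillation of [g]. *)
Lemma quadratic_modulus g a b e : a <= b -> {within `[a, b], continuous g} -> 0 < e ->
  exists2 L, 0 <= L & forall x y, a <= x <= b -> a <= y <= b ->
    `|g x - g y| <= e + L * (x - y) ^+ 2.
Proof.
move=> ab gc e0; have [d d0 hd] := uniform_continuity gc e0.
have [u _ gu] := EVT_max ab gc; have [w _ gw] := EVT_min ab gc.
pose K := `|g u - g w|.
exists (K / d ^+ 2) => [|x y xab yab]; first by rewrite divr_ge0 ?sqr_ge0 ?normr_ge0.
have [xy|xy] := ltP `|x - y| d.
  by apply: le_trans (hd _ _ xab yab xy) _; rewrite lerDl mulr_ge0 ?divr_ge0 ?sqr_ge0 ?normr_ge0.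
have gxy : `|g x - g y| <= K.
  rewrite ler_norml /K; have := ler_norm (g u - g w).
  have := gu x; have := gu y; have := gw x; have := gw y.
  rewrite !in_itv /= => /(_ yab) h1 /(_ xab) h2 /(_ yab) h3 /(_ xab) h4 h5.
  by apply/andP; split; lra.
have dxy : d ^+ 2 <= (x - y) ^+ 2.
  by rewrite -[leRHS]real_normK ?num_real // ler_sqr ?nnegrE ?normr_ge0 // ltW.
apply: (@le_trans _ _ (K / d ^+ 2 * (x - y) ^+ 2)); last by rewrite lerDr ltW.
apply: le_trans gxy _; rewrite mulrAC ler_pdivlMr ?exprn_gt0 //.
by rewrite ler_wpM2l // normr_ge0.
Qed.

(** With the modulus [e / 2 + L (s - t)^2] and the nodes [M k / n], the
    Bernstein polynomial is off by at most [e / 2] plus [L] times the variance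
    [M^2 x (1 - x) / n] of the rescaled binomial distribution. *)
Lemma weierstrass g M e : 0 < M -> {within `[0, M], continuous g} -> 0 < e ->
  exists p : {poly R}, forall t, 0 <= t <= M -> `|p.[t] - g t| <= e.
Proof.
move=> M0 gc e0; have e20 : 0 < e / 2 by exact: divr_gt0.
have [L L0 hL] := quadratic_modulus (ltW M0) gc e20.
pose K := L * M ^+ 2.
have K0 : 0 <= K by rewrite mulr_ge0 ?sqr_ge0.
have [n hn] : exists n : nat, K * n.+1%:R^-1 <= e / 2.
  have d0 : 0 < e / 2 / (K + 1) by rewrite divr_gt0 // ltr_wpDl.
  have [n _ /(_ n (leqnn n)) /= h] := near_infty_natSinv_lt (PosNum d0).
  exists n; move: h => /= /ltW; rewrite ler_pdivlMr ?ltr_wpDl //.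
  have : 0 <= n.+1%:R^-1 :> R by rewrite invr_ge0.
  by move: n.+1%:R^-1 => u; lra.
set N : R := n.+1%:R in hn; have N0 : 0 < N by rewrite ltr0n.
exists (bernstein n.+1 (fun k => g (M * (k%:R / N))) \Po (M^-1 *: 'X)) => t /andP[t0 tM].
rewrite horner_comp hornerZ hornerX; set x := M^-1 * t.
have xE : t = M * x by rewrite /x; field; rewrite gt_eqF.
have x01 : 0 <= x <= 1.
  by rewrite /x mulr_ge0 ?invr_ge0 ?(ltW M0) //= mulrC ler_pdivrMr // mul1r.
have tM' : 0 <= t <= M by rewrite t0.
have := @bernstein_dist n.+1 (fun k => g (M * (k%:R / N))) (g t) (e / 2) (K / N ^+ 2)
  (N * x) x x01.
rewrite -/N subrr expr0n add0r => h; apply: le_trans (h _) _ => [k kn|].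
  have kN : 0 <= M * (k%:R / N) <= M.
    rewrite mulr_ge0 ?divr_ge0 ?(ltW M0) ?(ltW N0) //= ler_piMr ?(ltW M0) //.
    by rewrite ler_pdivrMr // mul1r ler_nat.
  apply: le_trans (hL _ _ kN tM') _; rewrite lerD2l xE.
  by rewrite le_eqVlt; apply/orP; left; apply/eqP; rewrite /K; field; rewrite gt_eqF.
have -> : K / N ^+ 2 * (N * x * (1 - x)) = K * N^-1 * (x * (1 - x)).
  by field; rewrite gt_eqF.
rewrite [leRHS]splitr lerD2l (le_trans _ hn) // ler_piMr //.
  by rewrite mulr_ge0 // invr_ge0 ltW.
by move: x01 => /andP[x0 x1]; nra.
Qed.

End Weierstrass.

(** * Spectral bounds and absolute values *)

Section Positivity.
Variables (R : realType) (H : hilbertType R).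
Implicit Types (x y z : H) (a b c : R) (S T A : H -> H).

Lemma positive_scale a T : 0 <= a -> positive_operator T -> positive_operator (a%:C *: T).
Proof.
move=> a0 /positive_operatorP[Tb Ts Tpos]; apply/positive_operatorP; split.
- exact: bounded_scale.
- by move=> x y; rewrite !fctE rdotZl rdotZr Ts.
- by move=> x; rewrite !fctE rdotZl mulr_ge0.
Qed.

Lemma positive_sum n (T : 'I_n -> H -> H) :
  (forall i, positive_operator (T i)) -> positive_operator (\sum_i T i).
Proof.
move=> hT; have hP i := (positive_operatorP (T i)).1 (hT i).
apply/positive_operatorP; split.
- by apply: bounded_sum => i; have [] := hP i.
- move=> x y; rewrite fct_sumE (rdotC x) !rdot_suml.
  by apply: eq_bigr => i _; rewrite (rdotC _ x); have [_ ->] := hP i.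
- move=> x; rewrite fct_sumE rdot_suml sumr_ge0 // => i _.
  by have [_ _ ->] := hP i.
Qed.

(** Reduces identities between vectors to identities between real numbers. *)
Lemma rdot_inj x y : (forall z, rdot x z = rdot y z) -> x = y.
Proof.
move=> h; apply: subr0_eq; apply: nrm_eq0; apply/eqP; rewrite -sqrf_eq0 -rdotxx.
by rewrite {1}rdotDl rdotNl h subrr.
Qed.

Lemma spectrum_ge T a t : bounded_operator T ->
  (forall x, a * nrm x ^+ 2 <= rdot (T x) x) -> real_spectrum T t -> a <= t.
Proof.
move=> Tb hT st; rewrite leNgt; apply/negP => ta; apply: st.
apply: (@coercive_invertible _ _ _ 1 (a - t)); last 1 first.
- move=> x; rewrite scale1r !fctE /scalar_operator rdotDl rdotNl rdotZl rdotxx.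
  by rewrite mulrBl lerD2r.
- exact: bounded_sub Tb (bounded_scalar _ _).
- by rewrite subr_gt0.
Qed.

Lemma spectrum_le T b t : bounded_operator T ->
  (forall x, rdot (T x) x <= b * nrm x ^+ 2) -> real_spectrum T t -> t <= b.
Proof.
move=> Tb hT st; rewrite leNgt; apply/negP => ta; apply: st.
apply: (@coercive_invertible _ _ _ (-1) (t - b)); last 1 first.
- move=> x; rewrite scaleN1r !fctE /scalar_operator rdotNl rdotDl rdotNl rdotZl rdotxx.
  by have := hT x; lra.
- exact: bounded_sub Tb (bounded_scalar _ _).
- by rewrite subr_gt0.
Qed.

(** The spectrum of a scalar operator has at most one point, so a constant
    polynomial is exact on it. *)
Lemma cfc_scalar (f : R -> R) a :
  cfc f (scalar_operator a : H -> H) = scalar_operator (f a).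
Proof.
have ab := @bounded_scalar R H a.
apply: cfc_eq => //; first by move=> x y; rewrite rdotZl rdotZr.
split=> [|e e0]; first exact: bounded_scalar.
exists (f a)%:P; split=> [t st|x]; last first.
  by rewrite poly_opC subrr nrm0 mulr_ge0 ?nrm_ge0 // ltW.
suff -> : t = a by rewrite hornerC subrr normr0 ltW.
apply/eqP; rewrite eq_le (@spectrum_le _ a t ab _ st) ?(@spectrum_ge _ a t ab _ st) //.
  by move=> x; rewrite rdotZl rdotxx.
by move=> x; rewrite rdotZl rdotxx.
Qed.

(** Here [sqrt (q^2) = |q|]: a polynomial [p] close to the square root on [[0, 1]]
    is close to it on the spectrum of [q(T)^2], and [p o q^2] is close to [|q|] on
    the spectrum of [T], while both give the same operator. *)
Lemma has_cfc_abs (q : {poly R}) T : bounded_operator T -> selfadjoint T ->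
  (forall t, real_spectrum T t -> `|q.[t]| <= 1) ->
  has_cfc (fun t => `|q.[t]|) T (abs_operator (poly_operator q T)).
Proof.
move=> Tb Ts q1; have Tlin := bounded_lin Tb.
have Db := bounded_poly q Tb; have Ds := selfadjoint_poly q Tlin Ts.
set D := poly_operator q T in Db Ds *.
have DE : D \o D = poly_operator (q * q) T.
  by apply/funext => x; rewrite poly_opM.
have DDb := bounded_comp Db Db.
have DDs : selfadjoint (D \o D) by move=> x y; rewrite /= Ds Ds.
have DDspec t : real_spectrum (D \o D) t -> 0 <= t <= 1.
  move=> st; apply/andP; split.
    by apply: spectrum_ge st => // x; rewrite mul0r /= Ds rdotxx sqr_ge0.
  apply: spectrum_le st => // x; rewrite /= Ds rdotxx mul1r.
  have := poly_norm_le Tb Ts ler01 q1 x; rewrite mul1r -/D.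
  by rewrite ler_sqr ?nnegrE ?nrm_ge0.
have sqrt_approx e : 0 < e -> exists p : {poly R},
    forall t, 0 <= t <= 1 -> `|p.[t] - Num.sqrt t| <= e.
  move=> e0; apply: weierstrass => //.
  by apply: continuous_subspaceT => t; exact: sqrt_continuous.
have abs_approx e (p : {poly R}) :
    (forall t, 0 <= t <= 1 -> `|p.[t] - Num.sqrt t| <= e) ->
    forall t, real_spectrum T t -> `|(p \Po (q * q)).[t] - `|q.[t]| | <= e.
  move=> hp t st; rewrite horner_comp hornerM -expr2 -[`|q.[t]|]sqrtr_sqr hp //.
  by rewrite sqr_ge0 -[leLHS]real_normK ?num_real // exprn_ile1 ?q1.
have [S hS] : exists S, has_cfc (fun t => `|q.[t]|) T S.
  apply: has_cfc_exists => // e /sqrt_approx[p hp]; exists (p \Po (q * q)).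
  exact: abs_approx.
suff -> : abs_operator D = S by [].
apply: cfc_eq => //; split=> [|e e0]; first by have [] := hS.
have [p hp] := sqrt_approx e e0; exists p; split=> [t /DDspec /hp //|x].
rewrite DE -poly_op_comp //.
exact: has_cfc_approx hS (ltW e0) (abs_approx e p hp) x.
Qed.

End Positivity.

(** * The scalar inequality *)

Section ChordBound.
Variable R : realType.
Implicit Types (f : R -> R) (x y t M : R).

Lemma convex_le f x y t : convex_function (`[0, +oo[%classic : set R^o) f ->
  0 <= x -> 0 <= y -> 0 <= t <= 1 ->
  f (t * x + (1 - t) * y) <= t * f x + (1 - t) * f y.
Proof.
move=> fc x0 y0 /andP[t0 t1].
have := fc (Itv01 t0 t1) x y; rewrite !inE /= !in_itv /= !andbT => /(_ x0 y0).
by rewrite !convRE.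
Qed.

(** On each half of [[0, M]], the graph of [f] lies below the chord over
    that half; the two chords together are the right-hand side. *)
Lemma refined_chord_le f M t :
  convex_function (`[0, +oo[%classic : set R^o) f -> 0 < M -> 0 <= t <= M ->
  f t <= f 0 + (f M - f 0) / M * t
    - (f 0 + f M - 2 * f (M / 2)) * (1 / 2 - `|M^-1 * t - 1 / 2|).
Proof.
move=> fc M0 /andP[t0 tM]; set s := M^-1 * t.
have tE : t = M * s by rewrite /s; field; rewrite gt_eqF.
have s0 : 0 <= s by rewrite mulr_ge0 ?invr_ge0 // ltW.
have s1 : s <= 1 by rewrite /s mulrC ler_pdivrMr // mul1r.
have M2 : 0 <= M / 2 by rewrite divr_ge0 // ltW.
have -> : (f M - f 0) / M * t = (f M - f 0) * s by rewrite /s; field; rewrite gt_eqF.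
have [s2|s2] := lerP s (1 / 2).
  have st : 0 <= 2 * s <= 1 by apply/andP; split; lra.
  have := convex_le fc M2 (lexx 0) st.
  have -> : 2 * s * (M / 2) + (1 - 2 * s) * 0 = t by rewrite tE; field.
  lra.
have st : 0 <= 2 - 2 * s <= 1 by apply/andP; split; lra.
have := convex_le fc M2 (ltW M0) st.
have -> : (2 - 2 * s) * (M / 2) + (1 - (2 - 2 * s)) * M = t by rewrite tE; field.
lra.
Qed.

(** Midpoint convexity; this is the sign of [delta] in the second inequality. *)
Lemma midpoint_gap_ge0 f M :
  convex_function (`[0, +oo[%classic : set R^o) f -> 0 < M ->
  0 <= f 0 + f M - 2 * f (M / 2).
Proof.
move=> fc M0; have h : 0 <= (1 / 2 : R) <= 1 by apply/andP; split; lra.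
have := convex_le fc (lexx 0) (ltW M0) h.
have -> : 1 / 2 * 0 + (1 - 1 / 2) * M = M / 2 by field.
lra.
Qed.

End ChordBound.

(** * The operator inequality *)

Theorem corollary3p2 (R : realType) (H : hilbertType R) (f : R -> R)
    (f_cont : {within `[0, +oo[, continuous f})
    (f_convex : convex_function (`[0, +oo[%classic : set R^o) f)
    (n : nat) (B : 'I_n -> H -> H)
    (B_pos : forall i, positive_operator (B i))
    (M : R) (M_gt0 : 0 < M)
    (B_sum : \sum_(i < n) B i = scalar_operator M) :
  let delta := f 0 + f M - 2 * f (M / 2) in
  let Btilde := scalar_operator (n%:R / 2)
    - \sum_(i < n) abs_operator (M^-1%:C *: B i - scalar_operator (1 / 2)) in
  le_operator (\sum_(i < n) cfc f (B i))
    (cfc f (\sum_(i < n) B i) + scalar_operator ((n%:R - 1) * f 0)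
      - delta%:C *: Btilde) /\
  le_operator
    (cfc f (\sum_(i < n) B i) + scalar_operator ((n%:R - 1) * f 0)
      - delta%:C *: Btilde)
    (cfc f (\sum_(i < n) B i) + scalar_operator ((n%:R - 1) * f 0)).
Proof.
move=> delta Btilde.
have BP i := (positive_operatorP (B i)).1 (B_pos i).
have Bb i : bounded_operator (B i) by have [] := BP i.
have Bs i : selfadjoint (B i) by have [] := BP i.
have B0 i x : 0 <= rdot (B i x) x by have [_ _ ->] := BP i.
have BM i x : rdot (B i x) x <= M * nrm x ^+ 2.
  have -> : M * nrm x ^+ 2 = rdot ((\sum_j B j) x) x by rewrite B_sum rdotZl rdotxx.
  by rewrite fct_sumE rdot_suml (bigD1 i) //= lerDl sumr_ge0.
have Bspec i t : real_spectrum (B i) t -> 0 <= t <= M.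
  move=> st; apply/andP; split; last exact: spectrum_le st.
  by apply: spectrum_ge st => // x; rewrite mul0r.
have fS i : has_cfc f (B i) (cfc f (B i)).
  have [S hS] : exists S, has_cfc f (B i) S.
    apply: has_cfc_exists => // e e0.
    have fM : {within `[0, M], continuous f}.
      by apply: continuous_subspaceW f_cont => t /=; rewrite !in_itv /= => /andP[->].
    by have [p hp] := weierstrass M_gt0 fM e0; exists p => t /Bspec /hp.
  by rewrite (cfc_eq (Bb i) (Bs i) hS).
pose q : {poly R} := M^-1 *: 'X + (- (1 / 2))%:P.
have qE t : q.[t] = M^-1 * t - 1 / 2 by rewrite /q !hornerE.
pose D i := M^-1%:C *: B i - scalar_operator (1 / 2).
have DE i : D i = poly_operator q (B i).
  apply/funext => x; rewrite /q poly_opD poly_opZ poly_opC.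
  rewrite -['X]mul1r poly_opMX -polyC1 poly_opC scale1r.
  by rewrite /D !fctE /scalar_operator rmorphN scaleNr.
have absS i : has_cfc (fun t => `|M^-1 * t - 1 / 2|) (B i) (abs_operator (D i)).
  rewrite DE; apply: has_cfc_ext (has_cfc_abs (Bb i) (Bs i) _) => [t _|t]; first by rewrite qE.
  move=> /Bspec/andP[t0 tM]; rewrite qE.
  have h0 : 0 <= M^-1 * t by rewrite mulr_ge0 ?invr_ge0 // ltW.
  have h1 : M^-1 * t <= 1 by rewrite mulrC ler_pdivrMr // mul1r.
  by rewrite ler_norml; apply/andP; split; lra.
have constS a i : has_cfc (fun=> a) (B i) (scalar_operator a).
  have := has_cfc_poly a%:P (Bb i).
  have -> : poly_operator a%:P (B i) = scalar_operator a.
    by apply/funext => x; rewrite poly_opC.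
  by apply: has_cfc_ext => t _; rewrite hornerC.
have idS i : has_cfc id (B i) (B i).
  have := has_cfc_poly 'X (Bb i).
  have -> : poly_operator 'X (B i) = B i.
    apply/funext => x; rewrite -['X]mul1r poly_opMX -polyC1 poly_opC; exact: scale1r.
  by apply: has_cfc_ext => t _; rewrite hornerX.
have halfS i : has_cfc (fun t => 1 / 2 + (-1) * `|M^-1 * t - 1 / 2|) (B i)
    (scalar_operator (1 / 2) + (-1)%:C *: abs_operator (D i)).
  exact: has_cfcD (constS _ i) (has_cfcZ _ (absS i)).
(* each summand of [Btilde] is positive since [|t / M - 1/2| <= 1/2] *)
have half_pos i : positive_operator (scalar_operator (1 / 2) + (-1)%:C *: abs_operator (D i)).
  apply: has_cfc_pos (halfS i) _ => // t /Bspec/andP[t0 tM].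
  have h0 : 0 <= M^-1 * t by rewrite mulr_ge0 ?invr_ge0 // ltW.
  have h1 : M^-1 * t <= 1 by rewrite mulrC ler_pdivrMr // mul1r.
  have : `|M^-1 * t - 1 / 2| <= 1 / 2 by rewrite ler_norml; apply/andP; split; lra.
  lra.
(* the right-hand side minus the left-hand side of [refined_chord_le], at [B i] *)
pose G i := scalar_operator (f 0) + ((f M - f 0) / M)%:C *: B i
  + (- delta)%:C *: (scalar_operator (1 / 2) + (-1)%:C *: abs_operator (D i))
  + (-1)%:C *: cfc f (B i).
have G_pos i : positive_operator (G i).
  apply: (@has_cfc_pos _ _ (fun t => f 0 + (f M - f 0) / M * t
    + (- delta) * (1 / 2 + (-1) * `|M^-1 * t - 1 / 2|) + (-1) * f t) (B i)) => //.
    apply: has_cfcD (has_cfcZ _ (fS i)); apply: has_cfcD (has_cfcZ _ (halfS i)).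
    exact: has_cfcD (constS _ i) (has_cfcZ _ (idS i)).
  by move=> t /Bspec tM; have := refined_chord_le f_convex M_gt0 tM; rewrite -/delta; lra.
have BtildeE x y : rdot (Btilde x) y =
    \sum_i (1 / 2 * rdot x y - rdot (abs_operator (D i) x) y).
  rewrite sumrB -rdot_suml sumr_const card_ord /Btilde !fctE fct_sumE.
  by rewrite rdotDl rdotNl rdotZl -mulr_natl; ring.
split.
  rewrite /le_operator.
  suff -> : cfc f (\sum_(i < n) B i) + scalar_operator ((n%:R - 1) * f 0)
      - delta%:C *: Btilde - \sum_(i < n) cfc f (B i) = \sum_i G i.
    exact: positive_sum.
  apply/funext => x; apply: rdot_inj => y.
  rewrite B_sum cfc_scalar !fctE !fct_sumE !rdotDl !rdotNl !rdot_suml.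
  rewrite !rdotZl BtildeE.
  have BE : \sum_i rdot (B i x) y = M * rdot x y.
    by rewrite -rdotZl -[M%:C *: x]/(scalar_operator M x) -B_sum fct_sumE rdot_suml.
  have GE i : rdot (G i x) y = f 0 * rdot x y + (f M - f 0) / M * rdot (B i x) y
      - delta * (1 / 2 * rdot x y - rdot (abs_operator (D i) x) y)
      - rdot (cfc f (B i) x) y.
    by rewrite /G !fctE !(rdotDl, rdotZl); ring.
  rewrite [RHS](eq_bigr _ (fun i _ => GE i)) [in RHS]sumrB [in RHS]sumrB [in RHS]big_split /=.
  rewrite sumr_const card_ord -[in RHS]mulr_sumr BE -[in RHS]mulr_sumr.
  by field; rewrite gt_eqF.
rewrite /le_operator.
suff -> : cfc f (\sum_(i < n) B i) + scalar_operator ((n%:R - 1) * f 0)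
    - (cfc f (\sum_(i < n) B i) + scalar_operator ((n%:R - 1) * f 0) - delta%:C *: Btilde) =
    delta%:C *: \sum_i (scalar_operator (1 / 2) + (-1)%:C *: abs_operator (D i)).
  by apply: positive_scale; [exact: midpoint_gap_ge0|exact: positive_sum].
rewrite opprB addrCA subrr addr0; apply/funext => x; apply: rdot_inj => y.
rewrite !fctE !rdotZl BtildeE fct_sumE rdot_suml; congr (_ * _).
by apply: eq_bigr => i _; rewrite !fctE rdotDl !rdotZl; ring.
Qed.
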